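(* Let $n$ and $N$ be positive integers with $2n-3\ge N$, and let $\mathcal F_{n,N}$ be the family of graphs with $n$ vertices and sum index $N$. Then $\mathcal F_{n,N}$ is nonempty and $$\max\{|E(G)|: G\in\mathcal F_{n,N}\}\ge\frac{Nn}{2}-\frac{N^2}{8}-\frac{N}{4}+\epsilon$$ for some $\epsilon\ge-\frac18$ depending on $N$ and $n$; in particular, the maximum is at least $\frac{Nn}{2}-\frac{N^2}{8}-\frac{N}{4}-\frac18$.
   Context: For a finite simple graph $G=(V,E)$ and an injective map $f:V\to\mathbb Z$, let $\sigma(G,f)=\{f(v)+f(w): vw\in E\}$. The sum index of $G$ is $S(G)=\min_{f}|\sigma(G,f)|$ over all injective $f:V\to\mathbb Z$. *)

(* Defs.v *)
From HB Require Import structures.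
From mathcomp Require Import all_boot all_order all_algebra finmap.
From mathcomp Require Import boolp.

Set Implicit Arguments.
Unset Strict Implicit.
Unset Printing Implicit Defensive.

Import Order.TTheory GRing.Theory Num.Theory.

Local Open Scope fset_scope.

(* A simple graph on the vertex type T: an edge is an unordered pair of distinct
   vertices, i.e. a two-element subset of T (so [set v; v] is never an edge). *)
Record sgraph (T : finType) := SGraph {
  edges : {set {set T}};
  edges_card2 : [forall e in edges, #|e| == 2] }.

HB.instance Definition _ (T : finType) := [isSub for @edges T].
HB.instance Definition _ (T : finType) := [Finite of sgraph T by <:].

Definition sum_set (T : finType) (G : sgraph T) (f : T -> int) : {fset int} :=
  [fset (f p.1 + f p.2)%R | p in [pred p : T * T | [set p.1; p.2] \in edges G]].

(* k is the number of distinct edge sums of some injective labelling of G. *)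
Definition is_sum_card (T : finType) (G : sgraph T) (k : nat) : Prop :=
  exists f : T -> int, injective f /\ k = #|` sum_set G f|.

Lemma sum_card_exists (T : finType) (G : sgraph T) :
  exists k, `[< is_sum_card G k >].
Proof.
pose f (x : T) : int := Posz (enum_rank x).
exists #|` sum_set G f|; apply/asboolP; exists f; split=> // x y.
by move=> [] /val_inj /enum_rank_inj.
Qed.

Definition sum_index (T : finType) (G : sgraph T) : nat :=
  ex_minn (sum_card_exists G).

(* Graphs with n vertices are taken up to isomorphism, with vertex set 'I_n. *)
Definition sum_index_family (n N : nat) : {set sgraph 'I_n} :=
  [set G | sum_index G == N].

(* Main.v *)
Require Import Defs.
From mathcomp Require Import all_boot all_order all_algebra.
From mathcomp Require Import finmap boolp zify lra.

Import Order.TTheory GRing.Theory Num.Theory.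

Local Open Scope ring_scope.

(* Adding an edge raises the sum index by at most one, and the sum index of the
   complete graph is at least 2n - 3. Hence a graph with the most edges among
   those of sum index at most N has sum index exactly N, and it suffices to
   exhibit a graph with many edges and a labelling with at most N sums: label
   the vertices 0, ..., n - 1 and join i and j when i + j is one of N
   consecutive integers centred at n - 1. *)

Lemma set2_inj (T : finType) (v w x y : T) :
  [set v; w] = [set x; y] -> (v = x /\ w = y) \/ (v = y /\ w = x).
Proof.
move=> eq_vw.
have : v \in [set x; y] by rewrite -eq_vw set21.
have : w \in [set x; y] by rewrite -eq_vw set22.
have : x \in [set v; w] by rewrite eq_vw set21.
have : y \in [set v; w] by rewrite eq_vw set22.
rewrite !in_set2 => y_in x_in /orP[]/eqP Ew /orP[]/eqP Ev;
  move: y_in x_in; rewrite Ev Ew ?orbb; try by auto.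
- by move=> /eqP->; left.
- by move=> _ /eqP->; left.
Qed.

(** * Sum index: effect of adding edges, complete graphs, interpolation *)

Section SumIndex.

Variable T : finType.
Implicit Types (G : sgraph T) (f : T -> int).

Lemma sum_setP G f s :
  reflect (exists v w, [set v; w] \in edges G /\ s = f v + f w)
          (s \in sum_set G f).
Proof.
apply: (iffP (imfsetP _ _ _ _)) => [[[v w] /= vw ->]|[v [w [vw ->]]]].
  by exists v, w.
by exists (v, w).
Qed.

Lemma sum_set_card_le G f (s : seq int) :
  (forall v w, [set v; w] \in edges G -> f v + f w \in s) ->
  (#|` sum_set G f| <= size s)%N.
Proof.
move=> sub; apply: uniq_leq_size => [|x /sum_setP[v [w [vw ->]]]].
  exact: fset_uniq.
exact: sub.
Qed.

Lemma sum_index_le G f : injective f -> (sum_index G <= #|` sum_set G f|)%N.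
Proof.
move=> f_inj; rewrite /sum_index; case: ex_minnP => m _; apply.
by apply/asboolP; exists f.
Qed.

Lemma sum_index_attained G :
  exists2 f, injective f & sum_index G = #|` sum_set G f|.
Proof.
rewrite /sum_index; case: ex_minnP => m /asboolP[f [f_inj ->]] _.
by exists f.
Qed.

Lemma add_edge_card2 G (e : {set T}) :
  #|e| == 2 -> [forall e' in e |: edges G, #|e'| == 2].
Proof.
move=> e2; apply/forall_inP => e' /setU1P[-> //|].
exact: (forall_inP (edges_card2 G)).
Qed.

Definition add_edge G (e : {set T}) (e2 : #|e| == 2) : sgraph T :=
  SGraph (add_edge_card2 G e e2).

(** An optimal labelling of [G] is kept; the new edge contributes at most one new sum. *)
Lemma sum_index_add_edge G (e : {set T}) (e2 : #|e| == 2) :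
  (sum_index (add_edge G e e2) <= (sum_index G).+1)%N.
Proof.
have [f f_inj ->] := sum_index_attained G.
apply: leq_trans (sum_index_le _ f f_inj) _.
have /cards2P[x [y [xy e_xy]]] := e2.
apply: (sum_set_card_le _ f ((f x + f y) :: enum_fset (sum_set G f))) => v w.
case/setU1P => [|vw]; rewrite inE.
  by rewrite e_xy => /set2_inj[] [-> ->]; rewrite ?[f y + _]addrC eqxx.
by apply/orP; right; apply/sum_setP; exists v, w.
Qed.

(* The extreme labels f m < f M give the 2|T| - 3 sums f m + f v (v != m),
   all at most f m + f M, and f v + f M (v != m, M), all larger. *)
Lemma sum_index_complete G :
  (forall e : {set T}, #|e| == 2 -> e \in edges G) ->
  (2 * #|T| - 3 <= sum_index G)%N.
Proof.
move=> full; have [f f_inj ->] := sum_index_attained G.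
(* With at most one vertex the truncated difference is 0. *)
have [T1|T_gt1] := leqP #|T| 1; first by lia.
have /card_gt0P[x0 _] : (0 < #|T|)%N by lia.
pose m := [arg min_(v < x0) f v]%O; pose M := [arg max_(v > x0) f v]%O.
have m_le v : f m <= f v by rewrite /m; case: arg_minP => // i _; apply.
have le_M v : f v <= f M by rewrite /M; case: arg_maxP => // i _; apply.
have m_lt v : v != m -> f m < f v.
  by move=> vm; rewrite lt_neqAle m_le andbT (inj_eq f_inj) eq_sym.
have mM : M != m.
  apply/negP => /eqP Mm; move: T_gt1; rewrite leqNgt => /negP[].
  rewrite ltnS; apply/card_le1P => x _ y; rewrite !inE /=.
  by apply/esym/eqP/f_inj/le_anti; rewrite (le_trans (le_M y)) ?Mm //=
    (le_trans (le_M x)) ?Mm.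
pose A := enum (predC1 m); pose B := enum [predD1 predC1 m & M].
have sz : size ([seq f m + f v | v <- A] ++ [seq f v + f M | v <- B])
          = (2 * #|T| - 3)%N.
  rewrite size_cat !size_map -!cardE.
  have := cardD1 M (predC1 m); rewrite cardC1 inE /= mM add1n.
  by move=> /(congr1 predn)/= <-; lia.
rewrite -sz; apply: uniq_leq_size.
  rewrite cat_uniq !map_inj_uniq ?enum_uniq /= ?andbT; last first.
  - by move=> v w /addrI/f_inj.
  - by move=> v w /addIr/f_inj.
  apply/hasPn => _ /mapP[v + ->]; rewrite mem_enum !inE => /andP[_ vm].
  apply/negP => /mapP[w _] eq_s; have := m_lt v vm; have := le_M w; lia.
move=> s; rewrite mem_cat => /orP[]/mapP[v]; rewrite mem_enum !inE.
  move=> vm ->; apply/sum_setP; exists m, v; split=> //.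
  by apply: full; rewrite cards2 (eq_sym m) vm.
move=> /andP[vM _] ->; apply/sum_setP; exists v, M; split=> //.
by apply: full; rewrite cards2 vM.
Qed.

Lemma sum_index_interpolation G (N : nat) :
  (sum_index G <= N)%N -> (N <= 2 * #|T| - 3)%N ->
  exists2 H : sgraph T, sum_index H = N & (#|edges G| <= #|edges H|)%N.
Proof.
move=> G_le N_le.
case: (@arg_maxnP _ G (fun H => sum_index H <= N)%N (fun H => #|edges H|) G_le).
move=> H H_le H_max; exists H; last exact: H_max.
apply/eqP; rewrite eqn_leq H_le leqNgt; apply/negP => H_lt.
(* If the index of [H] were below [N], completeness of [H] would contradict the lower bound for
   complete graphs, while a missing edge could be added without exceeding [N], against
   maximality. *)
have [/forall_inP full|] :=
    boolP [forall (e : {set T} | #|e| == 2), e \in edges H].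
  by have := sum_index_complete H full; lia.
rewrite negb_forall_in => /exists_inP[e e2 eH].
have := H_max (add_edge H e e2) (leq_trans (sum_index_add_edge H e e2) H_lt).
by rewrite /= cardsU1 eH add1n ltnn.
Qed.

End SumIndex.

(** * Graphs of pairs whose sum lies in an interval *)

Section WindowGraph.

Variable n : nat.

(** Ordering the pairs makes each edge count once; the half-open interval makes cardinals additive
    under concatenation. *)
Definition window (a N : nat) : {set 'I_n * 'I_n} :=
  [set p : 'I_n * 'I_n | (p.1 < p.2)%N && (a <= p.1 + p.2 < a + N)%N].

Lemma window_edges_card2 a N :
  [forall e in [set [set p.1; p.2] | p in window a N], #|e| == 2].
Proof.
apply/forall_inP => _ /imsetP[p + ->]; rewrite inE => /andP[lt_p _].
by rewrite cards2 neq_ltn lt_p.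
Qed.

Definition window_graph a N : sgraph 'I_n := SGraph (window_edges_card2 a N).

Lemma card_window_graph a N : #|edges (window_graph a N)| = #|window a N|.
Proof.
apply: card_in_imset => -[i j] [k l]; rewrite !inE /= => /andP[ij _] /andP[kl _].
by case/set2_inj => -[Ei Ej]; move: ij kl; rewrite Ei Ej //; lia.
Qed.

Lemma sum_index_window_graph a N : (sum_index (window_graph a N) <= N)%N.
Proof.
pose f (i : 'I_n) : int := Posz i.
have f_inj : injective f by move=> i j [] /val_inj.
apply: leq_trans (sum_index_le _ _ f f_inj) _.
apply: leq_trans (sum_set_card_le _ _ f [seq Posz s | s <- iota a N] _) _;
  last by rewrite size_map size_iota.
move=> v w /imsetP[p + eq_vw]; rewrite inE => /andP[lt_p p_in].
apply/mapP; exists (v + w)%N => //; rewrite mem_iota.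
by case/set2_inj: eq_vw => -[-> ->]; rewrite // addnC.
Qed.

Lemma card_windowD a M N :
  #|window a (M + N)| = (#|window a M| + #|window (a + M) N|)%N.
Proof.
rewrite -(cardsID [set p : 'I_n * 'I_n | (p.1 + p.2 < a + M)%N]).
congr (_ + _)%N; apply: eq_card => p; rewrite !inE; lia.
Qed.

(* Witnesses: the pairs (lo + t, hi - t). *)
Lemma card_window1_ge lo hi :
  (hi < n)%N -> ((hi - lo).+1./2 <= #|window (lo + hi) 1|)%N.
Proof.
move=> hi_lt; pose i0 := Ordinal hi_lt.
(* The default [i0] is never returned: the range of [t] gives [lo + t < hi - t <= hi < n]. *)
pose g (t : 'I_((hi - lo).+1./2)) : 'I_n * 'I_n :=
  (insubd i0 (lo + t)%N, insubd i0 (hi - t)%N).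
have g1 t : (g t).1 = (lo + t)%N :> nat.
  by rewrite val_insubd; have := ltn_ord t; case: ifP; lia.
have g2 t : (g t).2 = (hi - t)%N :> nat.
  by rewrite val_insubd; have := ltn_ord t; case: ifP; lia.
have g_inj : injective g.
  by move=> t u eq_g; apply/val_inj/(@addnI lo); rewrite -!g1 eq_g.
rewrite -[leqLHS]card_ord -(card_imset _ g_inj); apply: subset_leq_card.
apply/subsetP => _ /imsetP[t _ ->]; rewrite inE g1 g2.
by have := ltn_ord t; lia.
Qed.

(** Passing from [k] to [k + 1] adds the sum [n - 1 + k] at the top and [n - 2 - k] at the bottom.
    Their counts are at least the floors of [(n - k) / 2] and [(n - k - 1) / 2], which add up to
    [n - k - 1]: the two roundings together cost only one half. *)
Lemma card_window_even k :
  (k < n)%N -> (2 * k * n <= 2 * #|window (n.-1 - k) k.*2| + k * k.+1)%N.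
Proof.
elim: k => [|k IH] k_lt; first by lia.
have := IH (ltnW k_lt).
have -> : (k.+1.*2 = 1 + (k.*2 + 1))%N by lia.
have top := @card_window1_ge k n.-1 ltac:(lia).
have bot := @card_window1_ge 0 (n.-1 - k.+1) ltac:(lia).
rewrite 2!card_windowD.
have -> : (n.-1 - k.+1 + 1 = n.-1 - k)%N by lia.
have -> : (n.-1 - k + k.*2 = k + n.-1)%N by lia.
rewrite add0n in bot; nia.
Qed.

(** The single extra sum [n - 1 + k] is not paired with another one, so its rounding may cost a
    further half; this turns [k * k.+1] into [k.+1 * k.+1]. *)
Lemma card_window_odd k :
  (k < n)%N ->
  ((2 * k + 1) * n <= 2 * #|window (n.-1 - k) k.*2.+1| + k.+1 * k.+1)%N.
Proof.
move=> k_lt; have := card_window_even k k_lt.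
have top := @card_window1_ge k n.-1 ltac:(lia).
rewrite -[k.*2.+1]addn1 card_windowD.
have -> : (n.-1 - k + k.*2 = k + n.-1)%N by lia.
nia.
Qed.

(** Both parities are multiplied by 4. With [k = N./2], the error [4k(k + 1)] is [N ^ 2 + 2 * N] for
    even [N], and [4(k + 1)^2] is [(N + 1) ^ 2] for odd [N]; the odd case is the source of the final
    1. *)
Lemma card_window_centred N :
  (N <= 2 * n - 3)%N ->
  (4 * N * n <= 8 * #|window (n.-1 - N./2) N| + N ^ 2 + 2 * N + 1)%N.
Proof.
move=> N_le; have [->|N_gt0] := posnP N; first by lia.
have k_lt : (N./2 < n)%N by lia.
have [oddN|evenN] := boolP (odd N).
  have := card_window_odd _ k_lt; have -> : N./2.*2.+1 = N by lia.
  nia.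
have := card_window_even _ k_lt; have -> : N./2.*2 = N by lia.
nia.
Qed.

End WindowGraph.

Theorem theorem3p5 (R : realFieldType) (n N : nat)
    (n_gt0 : (0 < n)%N) (N_gt0 : (0 < N)%N) (hnN : (N <= 2 * n - 3)%N) :
  let maxE : nat := (\max_(G in sum_index_family n N) #|edges G|)%N in
  let bound : R := N%:R * n%:R / 2 - N%:R ^+ 2 / 8 - N%:R / 4 in
  [/\ sum_index_family n N != set0,
      exists eps : R, - (1 / 8) <= eps /\ bound + eps <= maxE%:R
    & bound - 1 / 8 <= maxE%:R].
Proof.
move=> maxE bound.
have [|H H_index H_edges] := sum_index_interpolation _
  (window_graph n (n.-1 - N./2) N) N (sum_index_window_graph _ _ _).
  by rewrite card_ord.
have H_in : H \in sum_index_family n N by rewrite inE H_index.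
have maxE_ge : (#|edges H| <= maxE)%N.
  exact: (@leq_bigmax_cond _ _ (fun G : sgraph 'I_n => #|edges G|)).
have key : (4 * N * n <= 8 * maxE + N ^ 2 + 2 * N + 1)%N.
  have := card_window_centred n N hnN.
  by rewrite card_window_graph in H_edges; lia.
(* This is [key] divided by 8, the 1 becoming the loss of 1/8. *)
have bound_le : bound - 1 / 8 <= maxE%:R.
  move: key; rewrite -(ler_nat R) !natrD !natrM /bound; lra.
split=> //; first by apply/set0Pn; exists H.
by exists (- (1 / 8)).
Qed.
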